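(* Let $0<s<1$, $1<p<\frac{N}{s}$ and $0<\beta<\frac{N-ps}{2}$. Then there exists a constant $S(\beta)>0$ (independent of $u$) such that for all $u\in\mathcal{C}_0^\infty(\mathbb{R}^N)$, $$\int_{\mathbb{R}^{N}}\int_{\mathbb{R}^{N}}\frac{|u(x)-u(y)|^p}{|x-y|^{N+ps}}\,\frac{dx}{|x|^{\beta}}\,\frac{dy}{|y|^{\beta}}\;\ge\; S(\beta)\left(\int_{\mathbb{R}^N}\frac{|u(x)|^{p^*_{s}}}{|x|^{2\beta\frac{p^*_{s}}{p}}}\,dx\right)^{\frac{p}{p^*_{s}}},$$ where $p^*_s=\frac{pN}{N-ps}$.
   Context: $\mathcal{C}_0^\infty(\mathbb{R}^N)$ is the space of smooth compactly supported functions on $\mathbb{R}^N$. *)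

(* Defs.v *)
From HB Require Import structures.
From mathcomp Require Import all_boot all_order all_algebra.
From mathcomp Require Import all_classical all_reals all_analysis.

Set Implicit Arguments.
Unset Strict Implicit.
Unset Printing Implicit Defensive.

Import Order.TTheory GRing.Theory Num.Theory.
Import numFieldNormedType.Exports.

Local Open Scope classical_set_scope.
Local Open Scope ring_scope.

(* The sigma-algebra on R^n is generated by the coordinate maps, as for
   [n.-tuple T] in measurable_structure.v; it is the Borel sigma-algebra. *)
Section measurable_rV.
Context (R : realType) (n : nat).

Let coors (i : 'I_n) (v : 'rV[R]_n) : measurableTypeR R := v ord0 i.

Let rV_set0 : g_sigma_preimage coors set0.
Proof. exact: sigma_algebra0. Qed.

Let rV_setC A : g_sigma_preimage coors A -> g_sigma_preimage coors (~` A).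
Proof. exact: sigma_algebraC. Qed.

Let rV_bigcup (F : _^nat) : (forall i, g_sigma_preimage coors (F i)) ->
  g_sigma_preimage coors (\bigcup_i (F i)).
Proof. exact: sigma_algebra_bigcup. Qed.

HB.instance Definition _ :=
  @isMeasurable.Build (measure_tuple_display default_measure_display)
    'rV[R]_n (g_sigma_preimage coors) rV_set0 rV_setC rV_bigcup.

End measurable_rV.

Section lebesgue_rV.
Context (R : realType).

Lemma measurable_coord n (i : 'I_n) :
  measurable_fun [set: 'rV[R]_n] (fun v => v ord0 i : measurableTypeR R).
Proof.
move=> _ Y mY; rewrite setTI; apply: sub_sigma_algebra => /=.
rewrite -bigcup_seq/=; exists i => /=; first by rewrite mem_index_enum.
by exists Y => //; rewrite setTI.
Qed.

Lemma measurable_fun_rV d (T : measurableType d) n (f : T -> 'rV[R]_n) :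
  (forall i, measurable_fun [set: T] (fun x => f x ord0 i : measurableTypeR R)) ->
  measurable_fun [set: T] f.
Proof.
move=> mf; apply: (@measurability _ _ _ _ _ _
  (\big[setU/set0]_(i < n) preimage_set_system setT
     (fun v : 'rV[R]_n => v ord0 i : measurableTypeR R) measurable)) => //.
move=> _ [B + <-]; rewrite -bigcup_seq => -[i _ [C mC <-]].
by rewrite [X in _ @^-1` X]setTI; exact: mf.
Qed.

Definition cons_rV n (z : R * 'rV[R]_n) : 'rV[R]_n.+1 :=
  row_mx (z.1)%:M z.2 : 'rV[R]_(1 + n).

Lemma measurable_cons_rV n : measurable_fun
  [set: measurableTypeR R * 'rV[R]_n] (@cons_rV n : _ -> 'rV[R]_n.+1).
Proof.
apply: measurable_fun_rV => i.
have [[j ->]|[j ->]] : (exists j, i = @lshift 1 n j) \/ (exists j, i = @rshift 1 n j).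
  by case: (@split_ordP 1 n i) => j ->; [left|right]; exists j.
- rewrite (_ : (fun x => _) = fst); first exact: measurable_fst.
  by apply/funext => -[a v]; rewrite [LHS](@row_mxEl R 1 1 n) mxE (ord1 j) eqxx.
- rewrite (_ : (fun x => _) = (fun v : 'rV[R]_n => v ord0 j) \o snd).
    by apply: measurableT_comp; [exact: measurable_coord|exact: measurable_snd].
  by apply/funext => -[a v]; rewrite [LHS](@row_mxEr R 1 1 n).
Qed.

Local Open Scope ereal_scope.

Definition uncons_rV n (v : 'rV[R]_n.+1) : measurableTypeR R * 'rV[R]_n :=
  (v ord0 ord0, \row_(j < n) v ord0 (lift ord0 j)).

Lemma cons_rVK n : cancel (@cons_rV n) (@uncons_rV n).
Proof.
move=> [a v]; rewrite /uncons_rV; congr pair.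
  rewrite (_ : ord0 = @lshift 1 n ord0); last exact/val_inj.
  by rewrite [LHS](@row_mxEl R 1 1 n) mxE eqxx.
apply/rowP => j; rewrite mxE (_ : lift ord0 j = @rshift 1 n j).
  by rewrite [LHS](@row_mxEr R 1 1 n).
exact/val_inj.
Qed.

Lemma measurable_uncons_rV n :
  measurable_fun [set: 'rV[R]_n.+1] (@uncons_rV n).
Proof.
apply/measurable_fun_pairP; split; first exact: measurable_coord.
apply: measurable_fun_rV => i.
rewrite (_ : (fun x => _) = (fun x : 'rV[R]_n.+1 => x ord0 (lift ord0 i))).
  exact: measurable_coord.
by apply/funext => v /=; rewrite mxE.
Qed.

Section cons_measure.
Context n (mu : {sigma_finite_measure set 'rV[R]_n -> \bar R}).

Definition cons_measure : set 'rV[R]_n.+1 -> \bar R :=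
  pushforward (lebesgue_measure \x mu) (@cons_rV n).

Let mpreimage A : measurable A ->
  measurable ((@cons_rV n : measurableTypeR R * 'rV[R]_n -> _) @^-1` A).
Proof.
by move=> mA; rewrite -[X in measurable X]setTI; exact: measurable_cons_rV.
Qed.

Let cons_measure0 : cons_measure set0 = 0.
Proof. by rewrite /cons_measure /pushforward preimage_set0 measure0. Qed.

Let cons_measure_ge0 A : 0 <= cons_measure A.
Proof. exact: (measure_ge0 (lebesgue_measure \x mu)). Qed.

Let cons_measure_sigma_additive : semi_sigma_additive cons_measure.
Proof.
move=> F mF tF mUF; rewrite /cons_measure /pushforward preimage_bigcup.
apply: (measure_semi_sigma_additive (s := lebesgue_measure \x mu)).
- by move=> k; exact: mpreimage.
- apply/trivIsetP => /= i j _ _ ij; rewrite -preimage_setI.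
  by move/trivIsetP : tF => /(_ _ _ _ _ ij) ->//; rewrite preimage_set0.
- by rewrite -preimage_bigcup; exact: mpreimage.
Qed.

HB.instance Definition _ := isMeasure.Build _ _ _ cons_measure
  cons_measure0 cons_measure_ge0 cons_measure_sigma_additive.

Let cons_measure_sigma_finite : sigma_finite setT cons_measure.
Proof.
have /sigma_finiteP[F [FT ndF Foo]] := sigma_finiteT (@lebesgue_measure R).
have /sigma_finiteP[G [GT ndG Goo]] := sigma_finiteT mu.
exists (fun k => @uncons_rV n @^-1` (F k `*` G k)).
  rewrite -preimage_bigcup (_ : \bigcup_k _ = setT) ?preimage_setT//.
  rewrite -subTset => -[x y] _.
  have [i _ Fx] : (\bigcup_i F i) x by rewrite -FT.
  have [j _ Gy] : (\bigcup_i G i) y by rewrite -GT.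
  exists (maxn i j) => //; split.
    by move: x Fx; exact/subsetPset/ndF/leq_maxl.
  by move: y Gy; exact/subsetPset/ndG/leq_maxr.
move=> k; have [mF Fk] := Foo k; have [mG Gk] := Goo k; split.
  rewrite -[X in measurable X]setTI.
  by apply: measurable_uncons_rV => //; exact: measurableX.
rewrite /cons_measure /pushforward -comp_preimage.
rewrite (_ : @uncons_rV n \o @cons_rV n = id) ?preimage_id.
  by rewrite product_measure1E// lte_mul_pinfty// ge0_fin_numE.
by apply/funext => z; exact: cons_rVK.
Qed.

HB.instance Definition _ := Measure_isSigmaFinite.Build _ _ _ cons_measure
  cons_measure_sigma_finite.

End cons_measure.

(* Borel-Lebesgue measure on R^n, as the n-fold product of the one-dimensional
   one: R^0 carries the unit mass, and R^(m+1) is identified with R * R^m. *)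
Fixpoint lebesgue_rV n : {sigma_finite_measure set 'rV[R]_n -> \bar R} :=
  match n with
  | 0%N => dirac (0%R : 'rV[R]_0)
  | m.+1 => cons_measure (lebesgue_rV m)
  end.

Lemma lebesgue_rV_box n (A : 'I_n -> set (measurableTypeR R)) :
  (forall i, measurable (A i)) ->
  lebesgue_rV n [set v | forall i, A i (v ord0 i)] =
  \prod_(i < n) lebesgue_measure (A i).
Proof.
elim: n A => [|n IH] A mA /=.
  by rewrite big_ord0 /= diracE mem_set// => -[].
have mB : measurable
    [set v : 'rV[R]_n | forall i, A (lift ord0 i) (v ord0 i)].
  rewrite (_ : [set _ | _] = \bigcap_(i in setT)
      ((fun v : 'rV[R]_n => v ord0 i) @^-1` A (lift ord0 i))); last first.
    by apply/seteqP; split => v /= Av i; [move=> _|]; exact: Av.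
  apply: fin_bigcap_measurable => // i _.
  by rewrite -[X in measurable X]setTI; exact: measurable_coord.
rewrite big_ord_recl -IH// -product_measure1E//.
rewrite /cons_measure /pushforward; congr (product_measure1 _ _ _).
apply/seteqP; split => -[x v] /=; have := cons_rVK (x, v);
    rewrite /uncons_rV; move: (cons_rV _) => w [<- <-].
  by move=> Aw; split=> [|i]; [exact: Aw|rewrite mxE; exact: Aw].
move=> [A0 Av] i.
have [->//|i0] := eqVneq i ord0.
have [j ij|/eqP] := unliftP ord0 i; last by rewrite (negbTE i0).
by rewrite ij; have := Av j; rewrite mxE.
Qed.

End lebesgue_rV.

Section euclidean.
Context (R : realType) (N : nat).
Implicit Types (u : 'rV[R]_N -> R) (x : 'rV[R]_N).

(* The canonical norm [`|x|] of ['rV[R]_N] is the sup norm. *)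
Definition enorm x : R := Num.sqrt (\sum_(i < N) x ord0 i ^+ 2).

Definition partial (i : 'I_N) u : 'rV[R]_N -> R :=
  'D_(delta_mx ord0 i : 'rV[R]_N) u.

Fixpoint Ck (k : nat) u : Prop :=
  match k with
  | 0%N => continuous u
  | k'.+1 => [/\ continuous u,
      forall i x, derivable u x (delta_mx ord0 i : 'rV[R]_N) &
      forall i, Ck k' (partial i u)]
  end.

Definition smooth u : Prop := forall k, Ck k u.

Definition compactly_supported u : Prop :=
  compact (closure [set x | u x != 0]).

Definition test_function u : Prop := smooth u /\ compactly_supported u.

End euclidean.

(* p^*_s *)
Definition sobolev_exp (R : realType) (N : nat) (s p : R) : R :=
  p * N%:R / (N%:R - p * s).

(* Main.v *)
(* Write q = p^*_s, n = N, sig = p s, al = 2 beta q / p < n, w(x) = |u(x)|^q / |x|^al,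
   and let g(y) be the inner integral of the weighted Gagliardo seminorm.  Let
   I be the integral of w over {|x| >= e}, which is finite.  Comparing u(y) with
   the values of u on a cube of side r at distance about r from y, on the far
   side of 0, gives for every r > 0
     w(y) <= C w(y)^(sig/n) r^sig ((|y|+2r)/|y|)^beta g(y)
             + C r^-n ((|y|+2r)/|y|)^al (integral of w over the cube).
   If the scale r with r^n ~ I / w(y) is at most |y|, the last term is absorbed
   and w(y) <= C I^(sig/n) g(y).  Otherwise |y|^n w(y) <= C I, and r = K |y| gives
     w(y) <= C_K I^(sig/n) g(y) + C K^(al-n) |y|^-n (integral of w over |x| ~ K|y|).
   By Tonelli the integral over y of the last term is at most C K^(al-n) I, hence
   at most I/2 for K large.  So I <= 2 C_K I^(sig/n) G with G the integral of g,
   and 1 - sig/n = p/q gives I^(p/q) <= 2 C_K G; finally e -> 0. *)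

Require Import Defs.
From mathcomp Require Import all_boot all_order all_algebra.
From mathcomp Require Import all_classical all_reals all_analysis.
From mathcomp Require Import measurable_realfun lra ring.

Import Order.TTheory GRing.Theory Num.Theory.
Import numFieldNormedType.Exports.

Local Open Scope classical_set_scope.
Local Open Scope ring_scope.

(** * Borel measurability of open sets and continuous functions on R^n *)

(** The sigma-algebra is generated by coordinates, so an open set is written as the countable union
    of the boxes it contains, with rational centre and radius 1/(k+1). *)
Lemma open_measurable_rV (R : realType) (n : nat) (U : set 'rV[R]_n) :
  open U -> measurable U.
Proof.
move=> oU.
pose box (z : 'rV[rat]_n * nat) : set 'rV[R]_n :=
  \bigcap_(i in [set: 'I_n])
    [set v | ball (ratr (z.1 ord0 i) : R) z.2.+1%:R^-1 (v ord0 i)].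
have mbox z : measurable (box z).
  apply: fin_bigcap_measurable => // i _.
  rewrite -[X in measurable X]setTI.
  have mB : measurable (ball (ratr (z.1 ord0 i) : R) z.2.+1%:R^-1 :
      set (measurableTypeR R)) by apply: open_measurable; exact: ball_open.
  exact: (@measurable_coord R n i measurableT _ mB).
have -> : U = \bigcup_z (if `[< box z `<=` U >] then box z else set0).
  apply/seteqP; split => [x Ux|x [z _]]; last first.
    by case: ifPn => // /asboolP; apply.
  have /nbhs_ballP[e /= e0 xeU] := open_nbhs_nbhs (conj oU Ux).
  (* Two radii must fit into [e]: one from [x] to the rational centre, one from the centre to a
     point of the box. *)
  have [k ke] : exists k, k.+1%:R^-1 + k.+1%:R^-1 < e :> R.
    exists (Num.truncn (2 / e)); set k := Num.truncn _.
    have : 2 / e < k.+1%:R by exact: truncnS_gt.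
    rewrite ltr_pdivrMr// => h.
    by rewrite -mulr2n -[_ *+ 2]mulr_natl ltr_pdivrMr ?ltr0n// mulrC.
  have /choice[z zP] (i : 'I_n) : exists z : rat,
      ball (ratr z : R) k.+1%:R^-1 (x ord0 i).
    have /rat_in_itvoo[z] : x ord0 i - k.+1%:R^-1 < x ord0 i + k.+1%:R^-1.
      by rewrite ltrBlDr -addrA ltrDl addr_gt0// invr_gt0.
    rewrite in_itv/= => /andP[z1 z2]; exists z.
    by rewrite -ball_normE/= ltr_distl z1.
  exists (\row_i z i, k) => //.
  have bx : box (\row_i z i, k) x by move=> i _; rewrite /= mxE; exact: zP.
  suff bU : box (\row_i z i, k) `<=` U by move: bx; rewrite (asboolT bU).
  move=> v bv; apply: xeU; split => // i j; rewrite ord1.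
  have := zP j; have := bv j I; rewrite /= mxE => vz xz.
  rewrite /ball/=; apply: le_lt_trans ke.
  apply: (le_trans (ler_distD (ratr (z j) : R) _ _)); apply: lerD.
    by rewrite distrC; apply: ltW; exact: xz.
  by apply: ltW; exact: vz.
by apply: countable_bigcupT_measurable => [|z]; [exact: countableP|case: ifP].
Qed.

Lemma continuous_measurable_rV (R : realType) (n : nat) (u : 'rV[R]_n -> R) :
  continuous u -> measurable_fun [set: 'rV[R]_n] u.
Proof.
move=> /continuousP cu; apply: (measurability _ (RGenOpens.measurableE R)).
move=> _ [_ [a [b ->] <-]]; rewrite setTI.
apply: open_measurable_rV; apply: cu; exact: interval_open.
Qed.

(** * Euclidean norm against coordinates *)

Section enorm_theory.
Context {R : realType} {N : nat}.
Implicit Types x y : 'rV[R]_N.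

Lemma enorm_ge0 x : 0 <= enorm x.
Proof. exact: sqrtr_ge0. Qed.

Lemma coord_le_enorm x i : `|x ord0 i| <= enorm x.
Proof.
rewrite -sqrtr_sqr; apply: ler_wsqrtr.
by rewrite (bigD1 i)//= lerDl; apply: sumr_ge0 => j _; exact: sqr_ge0.
Qed.

(** The sum of N squares is at most N M^2, and N <= N^2. The factor N in place of sqrt N keeps roots
    out of the later constants. *)
Lemma enorm_le x (M : R) : 0 <= M -> (forall i, `|x ord0 i| <= M) ->
  enorm x <= N%:R * M.
Proof.
move=> M0 xM; have NM0 : 0 <= N%:R * M by rewrite mulr_ge0.
rewrite -[leRHS]ger0_norm// -sqrtr_sqr; apply: ler_wsqrtr.
apply: (@le_trans _ _ (\sum_(i < N) M ^+ 2)).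
  by apply: ler_sum => i _; rewrite -[leLHS]real_normK ?num_real// lerXn2r ?nnegrE.
rewrite sumr_const card_ord -[leLHS]mulr_natl exprMn ler_wpM2r ?sqr_ge0//.
by rewrite -natrX ler_nat; case: (N) => // m; rewrite leq_pmull.
Qed.

Lemma ler_enorm x y : (forall i, `|x ord0 i| <= `|y ord0 i|) ->
  enorm x <= enorm y.
Proof.
move=> xy; apply: ler_wsqrtr; apply: ler_sum => i _.
by rewrite -[leLHS]real_normK ?num_real// -[leRHS]real_normK ?num_real// lerXn2r ?nnegrE.
Qed.

Lemma enorm_gt0 x : x != 0 -> 0 < enorm x.
Proof.
move=> /eqP x0; rewrite lt_neqAle enorm_ge0 andbT; apply/eqP => e0.
apply: x0; apply/rowP => i; rewrite mxE; apply/eqP; rewrite -normr_le0 e0.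
exact: coord_le_enorm.
Qed.

Lemma measurable_enorm : measurable_fun [set: 'rV[R]_N] (@enorm R N).
Proof.
apply: (measurableT_comp (f := @Num.sqrt R)).
  by apply: continuous_measurable_fun; exact: sqrt_continuous.
apply: measurable_sum => i; apply: measurable_funX; exact: measurable_coord.
Qed.

End enorm_theory.

(** * The splitting inequality for powers, pointwise and integrated *)

Lemma measurable_fun_powR d (T : measurableType d) (R : realType) (D : set T)
    (f : T -> R) (p : R) :
  measurable_fun D f -> measurable_fun D (fun x => f x `^ p).
Proof. exact: (@measurableT_comp _ _ _ _ _ _ (@powR R ^~ p)). Qed.

(* Either |f| >= |t|/2 or |t - f| >= |t|/2; integrating this replaces the
   comparison of t with an average of f, and no Hoelder inequality is needed. *)
Lemma normr_powR_split (R : realType) (t f p q : R) : 0 < p -> p <= q ->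
  `|t| `^ q <= 2 `^ p * `|t| `^ (q - p) * `|t - f| `^ p + 2 `^ q * `|f| `^ q.
Proof.
move=> p0 pq; have q0 : 0 < q by exact: lt_le_trans pq.
have [tf|ft] := leP `|t| (2 * `|f|).
  apply: (@le_trans _ _ (2 `^ q * `|f| `^ q)).
    by rewrite -powRM//; apply: ge0_ler_powR => //; rewrite ?nnegrE ?mulr_ge0// ltW.
  by rewrite lerDr !mulr_ge0// powR_ge0.
have t0 : 0 < `|t| by rewrite (le_lt_trans _ ft)// mulr_ge0.
apply: (@le_trans _ _ (2 `^ p * `|t| `^ (q - p) * `|t - f| `^ p)); last first.
  by rewrite lerDl mulr_ge0// powR_ge0.
rewrite mulrAC -powRM// -[in leLHS](subrK p q) [leLHS]powRD; last first.
  by apply/implyP => _; rewrite gt_eqF.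
rewrite [leLHS]mulrC. rewrite ler_wpM2r ?powR_ge0//; apply: ge0_ler_powR.
- exact: ltW.
- by rewrite nnegrE.
- by rewrite nnegrE mulr_ge0.
have : `|t| <= `|t - f| + `|f| by rewrite -{1}(subrK f t) ler_normD.
lra.
Qed.

Lemma ge0_integral_le_scale d (T : measurableType d) (R : realType)
    (mu : {measure set T -> \bar R}) (B : set T) (f h : T -> R) (c : R) :
  measurable B -> measurable_fun setT f -> measurable_fun setT h ->
  0 <= c -> (forall x, 0 <= f x) -> (forall x, 0 <= h x) ->
  (forall x, B x -> f x <= c * h x) ->
  (\int[mu]_(x in B) (f x)%:E <= c%:E * \int[mu]_(x in B) (h x)%:E)%E.
Proof.
move=> mB mf mh c0 f0 h0 fh.
have mfB : measurable_fun B (EFin \o f).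
  by apply/measurable_EFinP; exact: measurable_funTS.
have mhB : measurable_fun B (EFin \o h).
  by apply/measurable_EFinP; exact: measurable_funTS.
rewrite -ge0_integralZl//; last by move=> x _; rewrite lee_fin.
apply: ge0_le_integral => //; first by move=> x _; rewrite lee_fin.
exact: measurable_funeM.
Qed.

(** Integration of [normr_powR_split] in the extended reals, where any of the integrals may be
    infinite. It is applied with [t] the value of [u] at a point and [B] a cube away from that
    point. *)
Lemma normr_powR_split_integral d (T : measurableType d) (R : realType)
    (mu : {measure set T -> \bar R}) (B : set T) (f : T -> R) (t p q : R) :
  measurable B -> measurable_fun setT f -> 0 < p -> p <= q ->
  ((`|t| `^ q)%:E * mu B <=
   (2 `^ p * `|t| `^ (q - p))%:E * \int[mu]_(x in B) (`|t - f x| `^ p)%:E +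
   (2 `^ q)%:E * \int[mu]_(x in B) (`|f x| `^ q)%:E)%E.
Proof.
move=> mB mf p0 pq.
have mfB : measurable_fun B f by exact: measurable_funTS.
have m1 : measurable_fun B (fun x => (`|t - f x| `^ p)%:E).
  apply/measurable_EFinP; apply: measurable_fun_powR.
  by apply: measurableT_comp => //; exact: measurable_funB.
have m2 : measurable_fun B (fun x => (`|f x| `^ q)%:E).
  apply/measurable_EFinP; apply: measurable_fun_powR.
  exact: measurableT_comp.
rewrite -integral_cst//.
rewrite -!ge0_integralZl//.
rewrite -ge0_integralD//; last 2 first.
- exact: measurable_funeM.
- exact: measurable_funeM.
apply: ge0_le_integral => //.
- by move=> x _; rewrite lee_fin powR_ge0.
- by apply: emeasurable_funD; exact: measurable_funeM.
by move=> x _; rewrite -!EFinM -EFinD lee_fin; exact: normr_powR_split.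
Qed.

(** * Cubes centred at the origin *)

Section centered_box.
Context {R : realType} {N : nat}.

Definition centered_box (l : R) : set 'rV[R]_N :=
  [set v | forall i, `[- l, l]%classic (v ord0 i)].

Lemma measurable_centered_box (l : R) : measurable (centered_box l).
Proof.
have mI : measurable (`[- l, l]%classic : set (measurableTypeR R)).
  exact: measurable_itv.
rewrite (_ : centered_box l =
    \bigcap_(i in setT) ((fun v : 'rV[R]_N => v ord0 i) @^-1` `[- l, l]%classic)).
  apply: fin_bigcap_measurable => // i _.
  rewrite -[X in measurable X]setTI.
  exact: (@measurable_coord R N i measurableT _ mI).
by apply/seteqP; split => v /= Av i; [move=> _|]; exact: Av.
Qed.

Lemma lebesgue_centered_box (l : R) : 0 <= l ->
  lebesgue_rV R N (centered_box l) = ((2 * l) `^ N%:R)%:E.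
Proof.
move=> l0; rewrite /centered_box.
rewrite (lebesgue_rV_box (A := fun=> `[- l, l]%classic)); last first.
  by move=> i; exact: measurable_itv.
rewrite (eq_bigr (fun _ => (2 * l)%:E)).
  by rewrite prodEFin prodr_const card_ord powR_mulrn// mulr_ge0.
move=> i _; rewrite lebesgue_measure_itv/= lte_fin.
(* For [l = 0] the interval is a single point and its measure comes from the other branch of the
   formula. *)
by case: ltP => h; [rewrite -EFinD|]; congr EFin; lra.
Qed.

(** Supremum times volume of a cube containing the support. It serves twice: for the finiteness of
    the truncated integral of a test function, and for the shell integrated in [y]. *)
Lemma integral_le_centered_box (f : 'rV[R]_N -> R) (c l : R) :
  measurable_fun setT f -> 0 <= c -> 0 <= l -> (forall x, 0 <= f x) ->
  (forall x, f x <= c) ->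
  (forall x, f x != 0 -> forall i, `|x ord0 i| <= l) ->
  (\int[lebesgue_rV R N]_x (f x)%:E <= (c * (2 * l) `^ N%:R)%:E)%E.
Proof.
move=> mf c0 l0 f0 fc fl.
have mB := measurable_centered_box l.
apply: (@le_trans _ _
  (\int[lebesgue_rV R N]_(x in centered_box l) (cst c%:E x))%E); last first.
  rewrite integral_cst// [X in (_ * X)%E](_ : _ = ((2 * l) `^ N%:R)%:E)//.
  exact: lebesgue_centered_box.
rewrite [leRHS]integral_mkcond; apply: ge0_le_integral => //.
- by move=> x _; rewrite lee_fin.
- exact/measurable_EFinP.
- by apply/(measurable_restrictT _ _).1 => //; exact: measurable_cst.
move=> x _; rewrite patchE; case: ifPn => [_|]; first by rewrite lee_fin.
rewrite notin_setE => xB; have [->//|/fl xl] := eqVneq (f x) 0.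
by case: xB => i; rewrite /= in_itv/= -ler_norml.
Qed.

End centered_box.

(** * Cubes placed on the far side of a point from the origin *)

Section outer_box.
Context {R : realType} {N : nat}.
Implicit Types x v : 'rV[R]_N.

(* A cube of side r at distance r from x, placed coordinatewise on the side of
   x that points away from 0, so that |v_i| >= |x_i| + r on it: a truncation of
   the weight near 0 is then inherited from x by the whole cube. *)
Definition outer_box x (r : R) : set 'rV[R]_N := [set v | forall i,
  (if 0 <= x ord0 i then `[x ord0 i + r, x ord0 i + 2 * r]
   else `[x ord0 i - 2 * r, x ord0 i - r])%classic (v ord0 i)].

Lemma lebesgue_outer_box x (r : R) : 0 <= r ->
  lebesgue_rV R N (outer_box x r) = (r ^+ N)%:E.
Proof.
move=> r0; rewrite /outer_box (lebesgue_rV_box (A := fun i =>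
  (if 0 <= x ord0 i then `[x ord0 i + r, x ord0 i + 2 * r]
   else `[x ord0 i - 2 * r, x ord0 i - r])%classic)); last first.
  by move=> i; case: ifP => _; exact: measurable_itv.
rewrite (eq_bigr (fun _ => r%:E)); last first.
  move=> i _; case: ifP => _; rewrite lebesgue_measure_itv/= lte_fin.
    case: ltP => h; [rewrite -EFinD|]; congr EFin; lra.
  case: ltP => h; [rewrite -EFinD|]; congr EFin; lra.
by rewrite prodEFin prodr_const card_ord.
Qed.

Lemma measurable_outer_box x (r : R) : measurable (outer_box x r).
Proof.
rewrite (_ : outer_box x r = \bigcap_(i in setT)
    ((fun v : 'rV[R]_N => v ord0 i) @^-1`
     (if 0 <= x ord0 i then `[x ord0 i + r, x ord0 i + 2 * r]
      else `[x ord0 i - 2 * r, x ord0 i - r])%classic)); last first.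
  by apply/seteqP; split => v /= Av i; [move=> _|]; exact: Av.
apply: fin_bigcap_measurable => // i _.
rewrite -[X in measurable X]setTI; apply: measurable_coord => //.
by case: ifP => _; exact: measurable_itv.
Qed.

Lemma outer_boxP x r v : 0 <= r -> outer_box x r v -> forall i,
  [/\ `|x ord0 i| + r <= `|v ord0 i|, `|v ord0 i| <= `|x ord0 i| + 2 * r &
      `|v ord0 i - x ord0 i| <= 2 * r].
Proof.
move=> r0 xv i; have := xv i; case: ifPn => [x0|]; last rewrite -ltNge => x0.
  rewrite /= in_itv/= => /andP[h1 h2].
  have v0 : 0 <= v ord0 i by lra.
  by rewrite (ger0_norm x0) (ger0_norm v0); split; rewrite ?ger0_norm; lra.
rewrite /= in_itv/= => /andP[h1 h2].
have v0 : v ord0 i <= 0 by lra.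
by rewrite (ltr0_norm x0) (ler0_norm v0); split; rewrite ?ler0_norm; lra.
Qed.

(** The four bounds serve, in order, to inherit the truncation from [x], to bound the shell from
    below, to bound the weight, and to bound the singular kernel. The second needs one coordinate to
    exist, hence [0 < N]. *)
Lemma outer_box_enorm x r v : (0 < N)%N -> 0 <= r -> outer_box x r v ->
  [/\ enorm x <= enorm v, r <= enorm v, enorm v <= N%:R * (enorm x + 2 * r) &
      enorm (v - x) <= N%:R * (2 * r)].
Proof.
move=> N0 r0 /(outer_boxP _ _ _ r0) H; split.
- by apply: ler_enorm => i; have [h _ _] := H i; lra.
- have [h _ _] := H (Ordinal N0).
  apply: (le_trans _ (coord_le_enorm v (Ordinal N0))).
  by have := normr_ge0 (x ord0 (Ordinal N0)); lra.
- apply: enorm_le; first by have := enorm_ge0 x; lra.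
  by move=> i; have [_ h _] := H i; have := coord_le_enorm x i; lra.
- by apply: enorm_le => [|i]; [lra|rewrite !mxE; case: (H i)].
Qed.

End outer_box.

(* The scale rho with rho^n = A I / w makes the I-term equal to w/2 when
   rho <= a; otherwise a^n w <= A I and the scale K a is used. *)
Lemma absorb_by_scale (R : realType) (n sig al be C1 C2 K w a I g h : R) :
  0 < n -> 0 < sig -> 0 <= al -> 0 <= be -> 0 < C1 -> 0 < C2 -> 1 <= K ->
  0 < w -> 0 < a -> 0 < I -> 0 <= g -> 0 <= h ->
  (forall r : R, 0 < r ->
     w <= C1 * w `^ (sig / n) * r `^ sig * ((a + 2 * r) / a) `^ be * g +
          C2 * r `^ (- n) * ((a + 2 * r) / a) `^ al * I) ->
  w <= C1 * w `^ (sig / n) * (K * a) `^ sig *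
           ((a + 2 * (K * a)) / a) `^ be * g +
       C2 * (K * a) `^ (- n) * ((a + 2 * (K * a)) / a) `^ al * h ->
  w <= 2 * C1 * (3 * K) `^ be * K `^ sig *
           (2 * C2 * 3 `^ al) `^ (sig / n) * I `^ (sig / n) * g +
       C2 * 3 `^ al * K `^ (al - n) * a `^ (- n) * h.
Proof.
move=> n0 sig0 al0 be0 C10 C20 K1 w0 a0 I0 g0 h0 Hr HK.
have K0 : 0 < K by lra.
(* The 3 bounds (a + 2 rho) / a when rho <= a, and the 2 leaves half of [w] to be absorbed. *)
set A := 2 * C2 * 3 `^ al.
have A0 : 0 < A by rewrite !mulr_gt0// powR_gt0.
have nth (x : R) : 0 <= x -> (x `^ n) `^ (sig / n) = x `^ sig.
  by move=> x0; rewrite -powRrM mulrC divfK// gt_eqF.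
have th0 : 0 <= sig / n by rewrite divr_ge0// ltW.
pose rho := (A * I / w) `^ n^-1.
have AIw0 : 0 < A * I / w by rewrite divr_gt0// mulr_gt0.
have rho0 : 0 < rho by rewrite powR_gt0.
have rhon : rho `^ n = A * I / w.
  by rewrite -powRrM mulVf ?gt_eqF// powRr1// ltW.
have h_ge0 : 0 <= C2 * 3 `^ al * K `^ (al - n) * a `^ (- n) * h.
  by rewrite !mulr_ge0 ?powR_ge0// ltW.
have [rhoa|arho] := leP rho a.
  have q3 : (a + 2 * rho) / a <= 3 by rewrite ler_pdivrMr//; lra.
  have q0 : 0 <= (a + 2 * rho) / a by rewrite divr_ge0//; lra.
  have Hrho := Hr _ rho0.
  have e1 : C2 * rho `^ (- n) * ((a + 2 * rho) / a) `^ al * I <= w / 2.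
    rewrite powRN rhon invf_div.
    rewrite (_ : w / 2 = C2 * (w / (A * I)) * 3 `^ al * I); last first.
      by rewrite /A; field; rewrite !gt_eqF ?powR_gt0.
    rewrite ler_wpM2r ?(ltW I0)// ler_wpM2l//.
      rewrite mulr_ge0 ?divr_ge0 ?mulr_ge0//;
        by rewrite ?(ltW I0) ?(ltW A0) ?(ltW w0) ?(ltW C20).
    by apply: ge0_ler_powR; rewrite ?nnegrE.
  have e2 : C1 * w `^ (sig / n) * rho `^ sig * ((a + 2 * rho) / a) `^ be * g <=
      C1 * (3 * K) `^ be * K `^ sig * A `^ (sig / n) * I `^ (sig / n) * g.
    (* By the choice of [rho], w rho^n = A I, so the power of [w] disappears. *)
    have -> : C1 * w `^ (sig / n) * rho `^ sig =
        C1 * (A `^ (sig / n) * I `^ (sig / n)).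
      rewrite -nth ?(ltW rho0)// -mulrA -powRM ?powR_ge0 ?(ltW w0)// rhon.
      by rewrite mulrCA divff ?gt_eqF// mulr1 powRM// ltW.
    rewrite ler_wpM2r//.
    rewrite [leRHS](_ : _ = C1 * (A `^ (sig / n) * I `^ (sig / n)) *
       ((3 * K) `^ be * K `^ sig)); last by ring.
    rewrite ler_wpM2l ?mulr_ge0 ?powR_ge0 ?(ltW C10)//.
    (* As K >= 1, one has 3 <= 3 K and 1 <= K^sig, so both regimes can share one coefficient of
       [g]. *)
    rewrite -[leLHS]mulr1; apply: ler_pM; rewrite ?powR_ge0//.
      apply: ge0_ler_powR; rewrite ?nnegrE//; first by rewrite mulr_ge0// ltW.
      by rewrite (le_trans q3)//; lra.
    rewrite (_ : 1 = 1 `^ sig); last by rewrite powR1.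
    by apply: ge0_ler_powR; rewrite ?nnegrE//; lra.
  (* Moving the w/2 of [e1] to the left produces the factor 2. *)
  rewrite [X in _ <= X + _](_ : _ = 2 * (C1 * (3 * K) `^ be * K `^ sig *
     A `^ (sig / n) * I `^ (sig / n) * g)); last by ring.
  move: Hrho e1 e2 h_ge0; lra.
apply: (le_trans HK).
have qE : (a + 2 * (K * a)) / a = 1 + 2 * K by field; rewrite gt_eqF.
have q0 : 0 <= 1 + 2 * K by lra.
(* From a < rho follows a^n <= rho^n = A I / w. This replaces the exact cancellation: it bounds
   w^(sig/n) a^sig by (A I)^(sig/n). *)
have wa : w * a `^ n <= A * I.
  rewrite mulrC -ler_pdivlMr// -rhon; apply: ge0_ler_powR; rewrite ?nnegrE ltW//.
rewrite qE; apply: lerD.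
  rewrite ler_wpM2r//.
  rewrite [leRHS](_ : _ = C1 * ((A `^ (sig / n) * I `^ (sig / n)) * K `^ sig) *
    (2 * (3 * K) `^ be)); last by ring.
  apply: ler_pM; rewrite ?powR_ge0// ?mulr_ge0 ?powR_ge0 ?(ltW C10)//.
    rewrite -mulrA ler_wpM2l ?(ltW C10)//.
    rewrite powRM ?(ltW K0) ?(ltW a0)// [K `^ sig * _]mulrC mulrA.
    rewrite ler_wpM2r ?powR_ge0//.
    rewrite -powRM ?(ltW A0) ?(ltW I0)// -nth ?(ltW a0)//.
    rewrite -powRM ?powR_ge0 ?(ltW w0)//.
    apply: ge0_ler_powR; rewrite ?nnegrE//.
      by rewrite mulr_ge0 ?powR_ge0 ?ltW.
    by rewrite mulr_ge0// ltW.
  apply: (@le_trans _ _ ((3 * K) `^ be)).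
    by apply: ge0_ler_powR; rewrite ?nnegrE//; lra.
  by have := powR_ge0 (3 * K) be; lra.
(* As 1 + 2 K <= 3 K, the ratio contributes at most 3^al K^al, which combines with (K a)^(-n) into
   K^(al-n) a^(-n). *)
rewrite ler_wpM2r//.
rewrite powRM ?(ltW K0) ?(ltW a0)//.
rewrite [leRHS](_ : _ = C2 * (K `^ (- n) * a `^ (- n)) * (3 `^ al * K `^ al)).
  rewrite ler_wpM2l ?mulr_ge0 ?powR_ge0 ?(ltW C20)//.
  rewrite -powRM ?(ltW K0)//.
  by apply: ge0_ler_powR; rewrite ?nnegrE//; lra.
rewrite powRD; first by ring.
by apply/implyP => _; rewrite gt_eqF.
Qed.

(** * Exponent relations, weighted power and Gagliardo kernel *)

Section weighted_fractional_sobolev.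
Context (R : realType) (N : nat) (p q sig be al : R).
Context (N_gt0 : (0 < N)%N) (p_gt0 : 0 < p).
Context (sig_gt0 : 0 < sig) (be_gt0 : 0 < be).
Context (qE : q * (N%:R - sig) = p * N%:R) (alE : al * p = 2 * be * q).
Context (sig_lt : sig < N%:R) (be_lt : 2 * be < N%:R - sig).
Implicit Types (u : 'rV[R]_N -> R) (x y : 'rV[R]_N) (r g J K e I G : R).

Local Notation n := (N%:R : R).
Local Notation mu := (lebesgue_rV R N).

Let n_gt0 : 0 < n. Proof. by rewrite ltr0n. Qed.

Let q_gt0 : 0 < q.
Proof. by rewrite -(pmulr_lgt0 _ (_ : 0 < n - sig)) ?subr_gt0// qE mulr_gt0. Qed.

Let p_le_q : p <= q.
Proof.
rewrite -(ler_pM2r (_ : 0 < n - sig)) ?subr_gt0// qE.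
by rewrite ler_wpM2l ?(ltW p_gt0)// gerBl ltW.
Qed.

(** Together with [al_thetaE] this gives w(y)^(sig/n) = |u(y)|^(q-p) |y|^(2 be - al), so the factor
    |u(y)|^(q-p) left by the splitting inequality becomes a power of w(y). *)
Let thetaE : q * (sig / n) = q - p.
Proof.
apply: (mulIf (lt0r_neq0 n_gt0)); rewrite mulrBl -qE -mulrA divfK ?gt_eqF//.
by ring.
Qed.

Let al_thetaE : al * (sig / n) = al - 2 * be.
Proof.
apply: (mulIf (lt0r_neq0 q_gt0)); rewrite -mulrA [_ * q]mulrC thetaE.
by rewrite mulrBr alE; ring.
Qed.

Let al_gt0 : 0 < al.
Proof. by rewrite -(pmulr_lgt0 _ p_gt0) alE !mulr_gt0. Qed.

(** Since q/p = n/(n - sig), al equals 2 be n/(n - sig), and the bound is the hypothesis [be_lt]. It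
    makes K^(al-n) small for large K. *)
Let al_lt : al < n.
Proof.
have s0 : 0 < n - sig by rewrite subr_gt0.
rewrite -(ltr_pM2r (mulr_gt0 p_gt0 s0)) mulrA alE -[2 * be * q * _]mulrA qE.
by rewrite mulrCA [ltRHS]mulrCA ltr_pM2l// mulrC ltr_pM2l.
Qed.

Definition weighted_power u x : R := `|u x| `^ q / enorm x `^ al.

(** For positive exponents the conventions 0^a = 0 and 1/0 = 0 give the value 0 on the diagonal and
    where [x] or [y] vanishes. *)
Definition gagliardo_kernel u y x : R :=
  `|u x - u y| `^ p / enorm (x - y) `^ (n + sig) / enorm x `^ be / enorm y `^ be.

Definition gagliardo_at u y : \bar R :=
  (\int[mu]_x (gagliardo_kernel u y x)%:E)%E.

Lemma weighted_power_ge0 u x : 0 <= weighted_power u x.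
Proof. by rewrite divr_ge0// powR_ge0. Qed.

Lemma gagliardo_kernel_ge0 u y x : 0 <= gagliardo_kernel u y x.
Proof. by rewrite !divr_ge0// powR_ge0. Qed.

Lemma measurable_weighted_power u : measurable_fun setT u ->
  measurable_fun setT (weighted_power u).
Proof.
move=> meas_u; rewrite (_ : weighted_power u =
    (fun x => `|u x| `^ q * enorm x `^ (- al))); last first.
  by apply/funext => x; rewrite /weighted_power powRN.
apply: measurable_funM; apply: measurable_fun_powR.
  exact: measurableT_comp.
exact: measurable_enorm.
Qed.

Lemma measurable_gagliardo_kernel u : measurable_fun setT u ->
  measurable_fun setT (fun z : 'rV[R]_N * 'rV[R]_N => gagliardo_kernel u z.1 z.2).
Proof.
move=> meas_u; rewrite (_ : (fun z => _) =
    (fun z : 'rV[R]_N * 'rV[R]_N => `|u z.2 - u z.1| `^ p *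
       enorm (z.2 - z.1) `^ (- (n + sig)) * enorm z.2 `^ (- be) *
       enorm z.1 `^ (- be))); last first.
  by apply/funext => -[y x]; rewrite /gagliardo_kernel !powRN.
have mfst : measurable_fun [set: 'rV[R]_N * 'rV[R]_N] fst by exact: measurable_fst.
have msnd : measurable_fun [set: 'rV[R]_N * 'rV[R]_N] snd by exact: measurable_snd.
apply: measurable_funM; [apply: measurable_funM; [apply: measurable_funM|]|];
    apply: measurable_fun_powR.
- apply: measurableT_comp => //; apply: measurable_funB.
    exact: (measurableT_comp meas_u msnd).
  exact: (measurableT_comp meas_u mfst).
- apply: (measurableT_comp (@measurable_enorm R N)); apply: measurable_fun_rV => i.
  rewrite (_ : (fun z => _) =
    (fun z : 'rV[R]_N * 'rV[R]_N => z.2 ord0 i - z.1 ord0 i)); last first.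
    by apply/funext => z; rewrite !mxE.
  apply: measurable_funB.
    exact: (@measurableT_comp _ _ _ _ _ _ (fun v : 'rV[R]_N => v ord0 i)
      _ _ (@measurable_coord R N i) msnd).
  exact: (@measurableT_comp _ _ _ _ _ _ (fun v : 'rV[R]_N => v ord0 i)
    _ _ (@measurable_coord R N i) mfst).
- exact: (measurableT_comp (@measurable_enorm R N) msnd).
- exact: (measurableT_comp (@measurable_enorm R N) mfst).
Qed.

Lemma measurable_gagliardo_at u : measurable_fun setT u ->
  measurable_fun setT (gagliardo_at u).
Proof.
move=> meas_u; apply: (@measurable_fun_fubini_tonelli_F _ _ _ _ _ mu
    (fun z => (gagliardo_kernel u z.1 z.2)%:E)).
  by apply/measurable_EFinP; exact: measurable_gagliardo_kernel.
by move=> z; rewrite lee_fin gagliardo_kernel_ge0.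
Qed.

Lemma gagliardo_at_ge0 u y : (0 <= gagliardo_at u y)%E.
Proof. by apply: integral_ge0 => x _; rewrite lee_fin gagliardo_kernel_ge0. Qed.

Let measurable_kernel1 u y : measurable_fun setT u ->
  measurable_fun setT (gagliardo_kernel u y).
Proof.
move=> /measurable_gagliardo_kernel mk.
exact: (measurableT_comp mk (pair1_measurable y)).
Qed.

(** * Pointwise estimate by comparison with an outer box *)

(** The integrated splitting inequality on the box, whose measure is r^n. There 0 < |x| <= n (|y| +
    2 r) and 0 < |x - y| <= 2 n r, so the kernel and the weight can be inserted at the cost of
    constants; the kernel integral is then enlarged to the whole space. *)
Lemma outer_box_estimate u y r : measurable_fun setT u ->
  0 < enorm y -> 0 < r ->
  ((`|u y| `^ q * r `^ n)%:E <=
   (2 `^ p * `|u y| `^ (q - p) * ((n * (2 * r)) `^ (n + sig) *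
      (n * (enorm y + 2 * r)) `^ be * enorm y `^ be))%:E * gagliardo_at u y +
   (2 `^ q * (n * (enorm y + 2 * r)) `^ al)%:E *
      \int[mu]_(x in outer_box y r) (weighted_power u x)%:E)%E.
Proof.
move=> meas_u y0 r0; set B := outer_box y r; set b := n * (enorm y + 2 * r).
have mB : measurable B by exact: measurable_outer_box.
have mk := measurable_kernel1 u y meas_u.
have r_ge0 := ltW r0.
have b_gt0 : 0 < b by rewrite mulr_gt0//; lra.
have r2_ge0 : 0 <= n * (2 * r) by rewrite !mulr_ge0.
have Bx x : B x -> [/\ 0 < enorm x, enorm x <= b, 0 < enorm (x - y) &
    enorm (x - y) <= n * (2 * r)].
  move=> Bx; have [h1 h2 h3 h4] := outer_box_enorm _ _ _ N_gt0 r_ge0 Bx.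
  split => //; first exact: lt_le_trans h2.
  apply: enorm_gt0; rewrite subr_eq0; apply/eqP => xy.
  have [+ _ _] := outer_boxP _ _ _ r_ge0 Bx (Ordinal N_gt0).
  by rewrite xy; lra.
have := @normr_powR_split_integral _ _ _ mu B u (u y) p q mB meas_u p_gt0 p_le_q.
have muB : mu B = (r `^ n)%:E by rewrite lebesgue_outer_box// powR_mulrn.
rewrite [X in (_ * X <= _)%E](_ : _ = (r `^ n)%:E)// -EFinM => /le_trans; apply.
have P0 (a e : R) : 0 <= a `^ e by exact: powR_ge0.
apply: leeD.
- set c := (_ `^ _ * b `^ _ * _); rewrite (EFinM (_ * _) c) -muleA.
  apply: lee_wpmul2l; first by rewrite lee_fin mulr_ge0.
  have c0 : 0 <= c by rewrite !mulr_ge0.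
  apply: (@le_trans _ _ (c%:E * \int[mu]_(x in B) (gagliardo_kernel u y x)%:E)%E).
    apply: ge0_integral_le_scale; [exact: mB| |exact: mk|exact: c0| | |].
    + apply: measurable_fun_powR; apply: measurableT_comp => //.
      exact: measurable_funB.
    + by move=> x; exact: P0.
    + by move=> x; exact: gagliardo_kernel_ge0.
    move=> x /Bx[x0 xb xy0 xyr]; rewrite distrC /gagliardo_kernel /c.
    have := P0 `|u x - u y| p; move: (`|u x - u y| `^ p) => U U0.
    have : enorm (x - y) `^ (n + sig) <= (n * (2 * r)) `^ (n + sig).
      by apply: ge0_ler_powR => //; rewrite ?nnegrE ?enorm_ge0// addr_ge0 ?ltW.
    have : enorm x `^ be <= b `^ be.
      by apply: ge0_ler_powR => //; rewrite ?nnegrE ?enorm_ge0// ltW.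
    have : 0 < enorm (x - y) `^ (n + sig) by rewrite powR_gt0.
    have : 0 < enorm x `^ be by rewrite powR_gt0.
    have : 0 < enorm y `^ be by rewrite powR_gt0.
    move: (enorm x `^ be) (enorm y `^ be) (b `^ be) => X Y X'.
    move: (enorm (x - y) `^ _) ((n * _) `^ _) => Z Z' Y0 X0 Z0 XX' ZZ'.
    (* The weight at [y] cancels, and both remaining ratios are at least 1. *)
    rewrite [leRHS](_ : _ = U * ((Z' / Z) * (X' / X))); last first.
      by field; rewrite !gt_eqF.
    rewrite -[leLHS]mulr1 ler_wpM2l// -[leLHS]mulr1.
    by apply: ler_pM; rewrite // ler_pdivlMr// mul1r.
  apply: lee_wpmul2l; first by rewrite lee_fin.
  apply: ge0_subset_integral => //; first exact/measurable_EFinP.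
  by move=> x _; rewrite lee_fin gagliardo_kernel_ge0.
- rewrite (EFinM (2 `^ q)) -muleA; apply: lee_wpmul2l; first by rewrite lee_fin.
  apply: ge0_integral_le_scale => //.
  + by apply: measurable_fun_powR; exact: measurableT_comp.
  + exact: measurable_weighted_power.
  + by move=> x; exact: weighted_power_ge0.
  move=> x /Bx[x0 xb _ _]; rewrite /weighted_power.
  rewrite mulrCA -[leLHS]mulr1 ler_wpM2l// ler_pdivlMr ?powR_gt0// mul1r.
  by apply: ge0_ler_powR; rewrite ?nnegrE ?enorm_ge0// ltW.
Qed.

Let C1 := 2 `^ p * (2 * n) `^ (n + sig) * n `^ be.
Let C2 := 2 `^ q * n `^ al.

(** Division of [outer_box_estimate] by |y|^al r^n, in the form that [absorb_by_scale] expects. [J]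
    is any upper bound for the box integral, so it can be the whole truncated integral or only its
    part on a shell. *)
Lemma outer_box_estimate_fine u y r g J : measurable_fun setT u ->
  0 < enorm y -> 0 < r -> u y != 0 -> gagliardo_at u y = g%:E ->
  (\int[mu]_(x in outer_box y r) (weighted_power u x)%:E <= J%:E)%E ->
  weighted_power u y <=
    C1 * weighted_power u y `^ (sig / n) * r `^ sig *
      ((enorm y + 2 * r) / enorm y) `^ be * g +
    C2 * r `^ (- n) * ((enorm y + 2 * r) / enorm y) `^ al * J.
Proof.
move=> meas_u y0 r0 uy gE JE; have := outer_box_estimate u y r meas_u y0 r0.
rewrite gE -EFinM => H.
have {H} : `|u y| `^ q * r `^ n <= 2 `^ p * `|u y| `^ (q - p) *
     ((n * (2 * r)) `^ (n + sig) * (n * (enorm y + 2 * r)) `^ be * enorm y `^ be) * g +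
     2 `^ q * (n * (enorm y + 2 * r)) `^ al * J.
  rewrite -lee_fin; apply: (le_trans H); rewrite EFinD leeD2l// [leRHS]EFinM.
  by rewrite lee_wpmul2l// lee_fin mulr_ge0 ?powR_ge0.
set a := enorm y; set t := `|u y|.
have t0 : 0 < t by rewrite normr_gt0.
have ar0 : 0 <= a + 2 * r by rewrite /a; lra.
have P1 (e : R) : 0 < a `^ e by rewrite powR_gt0.
have P2 (e : R) : 0 < r `^ e by rewrite powR_gt0.
rewrite /weighted_power -/a -/t => H.
have -> : (t `^ q / a `^ al) `^ (sig / n) = t `^ (q - p) * a `^ (2 * be) / a `^ al.
  rewrite powRM ?powR_ge0 ?invr_ge0 ?powR_ge0// -powRrM thetaE.
  rewrite -mulrA; congr (_ * _).
  rewrite -powRN -powRrM mulNr al_thetaE opprB powRB ?powRN//.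
  by rewrite [a == 0]gt_eqF// implybT.
rewrite -(ler_pM2r (mulr_gt0 (P1 al) (P2 n))).
rewrite [leLHS](_ : _ = t `^ q * r `^ n); last by field; rewrite gt_eqF.
have e1 : (n * (2 * r)) `^ (n + sig) = (2 * n) `^ (n + sig) * (r `^ n * r `^ sig).
  rewrite mulrA [n * 2]mulrC powRM ?(ltW r0) ?mulr_ge0 ?(ltW n_gt0)//.
  by rewrite [r `^ _]powRD// [r == 0]gt_eqF// implybT.
have e2 (e : R) : (n * (a + 2 * r)) `^ e = n `^ e * (a + 2 * r) `^ e.
  by rewrite powRM ?(ltW n_gt0).
have e3 (e : R) : ((a + 2 * r) / a) `^ e = (a + 2 * r) `^ e / a `^ e.
  by rewrite powRM ?invr_ge0 ?(ltW y0)// -powR_inv1 ?(ltW y0)// -powRrM mulN1r powRN.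
have e4 : a `^ (2 * be) = a `^ be * a `^ be.
  by rewrite (_ : 2 * be = be + be) ?powRD ?[a == 0]gt_eqF ?implybT//; ring.
apply: (le_trans H); rewrite e1 e4 !e2 !e3 powRN /C1 /C2 le_eqVlt.
by apply/orP; left; apply/eqP; field; rewrite !gt_eqF.
Qed.

(* Truncating away from 0 makes the weighted norm of a test function finite, as
   absorbing it requires, without integrating the singular weight. *)
Definition truncated_power e u x : R :=
  if e <= enorm x then weighted_power u x else 0.

(** For K >= 1 the shell contains the outer box of side K|y| at y. Unlike the box it depends on [y]
    only through |y|, so for fixed [x] it is again a shell in [y], ready for Tonelli. *)
Definition shell_power K e u y x : R :=
  if (K * enorm y <= enorm x) && (enorm x <= 3 * n * K * enorm y)
  then truncated_power e u x else 0.

Lemma truncated_power_ge0 e u x : 0 <= truncated_power e u x.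
Proof. by rewrite /truncated_power; case: ifP; rewrite ?weighted_power_ge0. Qed.

Lemma shell_power_ge0 K e u y x : 0 <= shell_power K e u y x.
Proof. by rewrite /shell_power; case: ifP; rewrite ?truncated_power_ge0. Qed.

Lemma measurable_truncated_power e u : measurable_fun setT u ->
  measurable_fun setT (truncated_power e u).
Proof.
move=> meas_u; apply: measurable_fun_ifT => //.
  by apply: measurable_fun_ler => //; exact: measurable_enorm.
exact: measurable_weighted_power.
Qed.

Lemma measurable_shell_power K e u : measurable_fun setT u ->
  measurable_fun setT (fun z : 'rV[R]_N * 'rV[R]_N => shell_power K e u z.1 z.2).
Proof.
move=> meas_u.
have mfst : measurable_fun [set: 'rV[R]_N * 'rV[R]_N] fst by exact: measurable_fst.
have msnd : measurable_fun [set: 'rV[R]_N * 'rV[R]_N] snd by exact: measurable_snd.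
have m1 := measurableT_comp (@measurable_enorm R N) mfst.
have m2 := measurableT_comp (@measurable_enorm R N) msnd.
apply: measurable_fun_ifT => //.
  apply: measurable_and; apply: measurable_fun_ler => //;
    by apply: measurable_funM => //; exact: measurable_cst.
exact: (measurableT_comp (measurable_truncated_power e u meas_u) msnd).
Qed.

(* The bound does not depend on K: |y|^-n on the shell is of order (K/|x|)^n,
   and the shell, as a set of y, lies in a cube of side 2|x|/K. *)
Lemma shell_power_integral K e u x : measurable_fun setT u -> 0 < K -> 0 < e ->
  (\int[mu]_y (enorm y `^ (- n) * shell_power K e u y x)%:E <=
   ((6 * n) `^ n * truncated_power e u x)%:E)%E.
Proof.
move=> meas_u K0 e0.
have [ex|xe] := leP e (enorm x); last first.
  have W0 : truncated_power e u x = 0 by rewrite /truncated_power leNgt xe.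
  rewrite W0 mulr0 integral0_eq// => y _.
  by rewrite /shell_power W0 if_same mulr0.
set a := enorm x; have a0 : 0 < a by exact: lt_le_trans ex.
set W := truncated_power e u x; have W0 : 0 <= W by exact: truncated_power_ge0.
have nK0 : 0 < 3 * n * K by rewrite !mulr_gt0.
have aK0 : 0 <= a / K by rewrite divr_ge0// ltW.
(* 3 n K / a bounds 1/|y| on the shell and 2 a / K is the side of the cube; in the product [K]
   cancels and 6 n remains. *)
have -> : (6 * n) `^ n * W = (3 * n * K / a) `^ n * W * (2 * (a / K)) `^ n.
  rewrite mulrAC -powRM ?mulr_ge0 ?invr_ge0 ?(ltW n_gt0) ?(ltW a0) ?(ltW K0)//.
  by congr (_ `^ _ * _); field; rewrite !gt_eqF.
apply: integral_le_centered_box => //.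
- apply: measurable_funM.
    by apply: measurable_fun_powR; exact: measurable_enorm.
  exact: (measurableT_comp (measurable_shell_power K e u meas_u) (pair2_measurable x)).
- by rewrite mulr_ge0 ?powR_ge0.
- by move=> y; rewrite mulr_ge0 ?powR_ge0 ?shell_power_ge0.
- move=> y; rewrite /shell_power -/a -/W; case: ifPn => [/andP[h1 h2]|_]; last first.
    by rewrite mulr0 mulr_ge0 ?powR_ge0.
  have y0 : 0 < enorm y by rewrite -(pmulr_rgt0 _ nK0); exact: lt_le_trans h2.
  rewrite ler_wpM2r//.
  have -> : enorm y `^ (- n) = (enorm y)^-1 `^ n.
    by rewrite -powR_inv1 ?enorm_ge0// -powRrM mulN1r.
  apply: ge0_ler_powR; rewrite ?nnegrE ?(ltW n_gt0) ?invr_ge0 ?(ltW y0)//.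
    by rewrite divr_ge0 ?(ltW nK0) ?(ltW a0).
  by rewrite ler_pdivlMr// mulrC ler_pdivrMr.
- move=> y; rewrite /shell_power -/a; case: ifPn => [/andP[h1 _]|]; last first.
    by rewrite mulr0 eqxx.
  move=> _ i; apply: le_trans (coord_le_enorm _ _) _.
  by rewrite ler_pdivlMr// mulrC.
Qed.

Lemma truncated_power_integral_lty e u (M l : R) : measurable_fun setT u ->
  0 < e -> 0 <= l -> (forall x, `|u x| <= M) ->
  (forall x, u x != 0 -> forall i, `|x ord0 i| <= l) ->
  (\int[mu]_x (truncated_power e u x)%:E < +oo)%E.
Proof.
move=> meas_u e0 l0 uM ul.
apply: (@le_lt_trans _ _ (M `^ q / e `^ al * (2 * l) `^ n)%:E); last exact: ltry.
apply: integral_le_centered_box => //.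
- exact: measurable_truncated_power.
- by rewrite divr_ge0 ?powR_ge0.
- by move=> x; exact: truncated_power_ge0.
- move=> x; rewrite /truncated_power; case: ifPn => ex; last first.
    by rewrite divr_ge0 ?powR_ge0.
  have x0 : 0 < enorm x by exact: lt_le_trans ex.
  rewrite /weighted_power; apply: ler_pM; rewrite ?invr_ge0 ?powR_ge0//.
    apply: ge0_ler_powR; rewrite ?nnegrE ?(ltW q_gt0)//.
    exact: le_trans (uM x).
  rewrite lef_pV2 ?posrE ?powR_gt0//; apply: ge0_ler_powR => //.
  + exact: ltW.
  + by rewrite nnegrE ltW.
  + by rewrite nnegrE ltW.
- move=> x; rewrite /truncated_power; case: ifPn; last by rewrite eqxx.
  move=> _ wx; apply: ul; apply: contraNneq wx => ux.
  by rewrite /weighted_power ux normr0 powR0 ?mul0r// gt_eqF.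
Qed.

(** * Absorption of the shell term and choice of the scale factor *)

Let C3 K := 2 * C1 * (3 * K) `^ be * K `^ sig * (2 * C2 * 3 `^ al) `^ (sig / n).
(** [C3 K], multiplied by I^(sig/n), and [D K], multiplied by |y|^(-n), are the coefficients in the
    conclusion of [absorb_by_scale]. *)
Let D K := C2 * 3 `^ al * K `^ (al - n).

Let C1_gt0 : 0 < C1.
Proof. by rewrite !mulr_gt0 ?powR_gt0 ?mulr_gt0. Qed.

Let C2_gt0 : 0 < C2.
Proof. by rewrite mulr_gt0 ?powR_gt0. Qed.

Let C3_gt0 K : 0 < K -> 0 < C3 K.
Proof.
move=> K0; have K3 : 0 < 3 * K by rewrite mulr_gt0.
have A0 : 0 < 2 * C2 * 3 `^ al.
  by apply: mulr_gt0; [exact: mulr_gt0|exact: powR_gt0].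
by do 3 (apply: mulr_gt0; last exact: powR_gt0); exact: mulr_gt0.
Qed.

Let D_gt0 K : 0 < K -> 0 < D K.
Proof.
by move=> K0; do 2 (apply: mulr_gt0; last exact: powR_gt0).
Qed.

(** Outside the trivial cases (left side 0, or [gagliardo_at u y] infinite) this is
    [absorb_by_scale] with a = |y|: every scale [r] is compared with the full integral [I], the
    single scale K|y| with the shell. *)
Lemma truncated_power_estimate K e u y I : measurable_fun setT u ->
  1 <= K -> 0 < e -> 0 < I ->
  (\int[mu]_x (truncated_power e u x)%:E = I%:E)%E ->
  ((truncated_power e u y)%:E <=
   (C3 K * I `^ (sig / n))%:E * gagliardo_at u y +
   (D K)%:E * \int[mu]_x (enorm y `^ (- n) * shell_power K e u y x)%:E)%E.
Proof.
move=> meas_u K1 e0 I0 IE; have K0 : 0 < K by lra.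
have coef0 : 0 < C3 K * I `^ (sig / n) by rewrite mulr_gt0 ?powR_gt0 ?C3_gt0.
have shell0 : (0 <= \int[mu]_x (enorm y `^ (- n) * shell_power K e u y x)%:E)%E.
  by apply: integral_ge0 => x _; rewrite lee_fin mulr_ge0 ?powR_ge0 ?shell_power_ge0.
have D0 : (0 <= (D K)%:E * \int[mu]_x (enorm y `^ (- n) * shell_power K e u y x)%:E)%E.
  by rewrite mule_ge0// lee_fin ltW ?D_gt0.
have rhs0 : (0 <= (C3 K * I `^ (sig / n))%:E * gagliardo_at u y +
   (D K)%:E * \int[mu]_x (enorm y `^ (- n) * shell_power K e u y x)%:E)%E.
  by apply: adde_ge0 => //; rewrite mule_ge0 ?gagliardo_at_ge0// lee_fin ltW.
rewrite {1}/truncated_power; case: ifPn => // ey.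
have [uy|uy] := eqVneq (u y) 0.
  by rewrite /weighted_power uy normr0 powR0 ?mul0r// gt_eqF.
have y0 : 0 < enorm y by exact: lt_le_trans ey.
have w0 : 0 < weighted_power u y by rewrite divr_gt0 ?powR_gt0 ?normr_gt0.
have := gagliardo_at_ge0 u y.
case gE : (gagliardo_at u y) => [g| |]//; last first.
  by move=> _; rewrite gt0_muley ?lte_fin// addye ?leey// -ltNye (lt_le_trans _ D0).
rewrite lee_fin => g0.
have mW : measurable_fun setT (fun x => (truncated_power e u x)%:E).
  by apply/measurable_EFinP; exact: measurable_truncated_power.
have mH : measurable_fun setT (fun x => (shell_power K e u y x)%:E).
  apply/measurable_EFinP.
  exact: (measurableT_comp (measurable_shell_power K e u meas_u) (pair1_measurable y)).
set H := (\int[mu]_x (shell_power K e u y x)%:E)%E.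
have H0 : (0 <= H)%E by apply: integral_ge0 => x _; rewrite lee_fin shell_power_ge0.
have HI : (H <= I%:E)%E.
  rewrite -IE; apply: ge0_le_integral => // x _; rewrite lee_fin.
    exact: shell_power_ge0.
  by rewrite /shell_power; case: ifP => // _; exact: truncated_power_ge0.
have Hfin : H \is a fin_num by rewrite ge0_fin_numE// (le_lt_trans HI) ?ltry.
have box_le r f : 0 < r -> measurable_fun setT (fun x => (f x)%:E) ->
    (forall x, 0 <= f x) ->
    (forall x, outer_box y r x -> weighted_power u x <= f x) ->
    (\int[mu]_(x in outer_box y r) (weighted_power u x)%:E <= \int[mu]_x (f x)%:E)%E.
  move=> r0 mf f0 wf.
  apply: (@le_trans _ _ (\int[mu]_(x in outer_box y r) (f x)%:E)%E).
    apply: ge0_le_integral.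
    - exact: measurable_outer_box.
    - by move=> x _; rewrite lee_fin weighted_power_ge0.
    - apply/measurable_EFinP; apply: measurable_funTS.
      exact: measurable_weighted_power.
    - exact: measurable_funTS.
    - by move=> x /wf; rewrite lee_fin.
  apply: ge0_subset_integral => //; first exact: measurable_outer_box.
  by move=> x _; rewrite lee_fin.
rewrite (_ : (\int[mu]_x _)%E = (enorm y `^ (- n))%:E * H)%E; last first.
  rewrite -ge0_integralZl//; last 2 first.
  - by move=> x _; rewrite lee_fin shell_power_ge0.
  - by rewrite lee_fin powR_ge0.
rewrite -(fineK Hfin) -!EFinM -EFinD lee_fin mulrA.
apply: (absorb_by_scale R n sig al be C1 C2 K) => //.
- exact: ltW.
- exact: ltW.
- exact: fine_ge0.
- move=> r r0; apply: outer_box_estimate_fine => //.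
  rewrite -IE; apply: box_le => // [x|x xB]; first exact: truncated_power_ge0.
  (* On the outer box |x| >= |y| >= e, so the truncation does not cut into it. *)
  have [h _ _ _] := outer_box_enorm _ _ _ N_gt0 (ltW r0) xB.
  by rewrite /truncated_power (le_trans ey h).
- have Ka0 : 0 < K * enorm y by rewrite mulr_gt0.
  apply: outer_box_estimate_fine => //.
  rewrite fineK//; apply: box_le => // [x|x xB]; first exact: shell_power_ge0.
  have [h1 h2 h3 _] := outer_box_enorm _ _ _ N_gt0 (ltW Ka0) xB.
  rewrite /shell_power /truncated_power (le_trans ey h1) h2/= ifT//.
  (* The outer radius of the shell: n (1 + 2 K)|y| <= 3 n K |y|, by K >= 1. *)
  apply: (le_trans h3).
  rewrite (_ : 3 * n * K * enorm y = n * (3 * K * enorm y)); last by ring.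
  rewrite ler_wpM2l// (_ : enorm y + _ = (1 + 2 * K) * enorm y); last by ring.
  by rewrite ler_wpM2r ?(ltW y0)//; lra.
Qed.

(** The pointwise estimate is integrated in [y]. In the shell term Tonelli puts the integral over
    [y] inside, where [shell_power_integral] returns the truncated power at [x], hence a multiple of
    [I]. *)
Lemma truncated_power_integral_le K e u I : measurable_fun setT u ->
  1 <= K -> 0 < e -> 0 < I ->
  (\int[mu]_x (truncated_power e u x)%:E = I%:E)%E ->
  (I%:E <= (C3 K * I `^ (sig / n))%:E * \int[mu]_y gagliardo_at u y +
           (D K * (6 * n) `^ n)%:E * I%:E)%E.
Proof.
move=> meas_u K1 e0 I0 IE; have K0 : 0 < K by lra.
have coef0 : 0 < C3 K * I `^ (sig / n) by rewrite mulr_gt0 ?powR_gt0 ?C3_gt0.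
have mW : measurable_fun setT (fun x => (truncated_power e u x)%:E).
  by apply/measurable_EFinP; exact: measurable_truncated_power.
pose F (z : 'rV[R]_N * 'rV[R]_N) : \bar R :=
  (enorm z.1 `^ (- n) * shell_power K e u z.1 z.2)%:E.
have F0 z : (0 <= F z)%E by rewrite lee_fin mulr_ge0 ?powR_ge0 ?shell_power_ge0.
have mF : measurable_fun setT F.
  apply/measurable_EFinP; apply: measurable_funM.
    apply: measurable_fun_powR.
    exact: (measurableT_comp (@measurable_enorm R N) (@measurable_fst _ _ _ _)).
  exact: measurable_shell_power.
have mFF : measurable_fun setT (fun y => \int[mu]_x F (y, x))%E.
  exact: (@measurable_fun_fubini_tonelli_F _ _ _ _ _ mu F).
have mg := measurable_gagliardo_at u meas_u.
apply: (@le_trans _ _ (\int[mu]_y ((C3 K * I `^ (sig / n))%:E * gagliardo_at u y +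
   (D K)%:E * \int[mu]_x F (y, x)))%E).
  rewrite -{1}IE; apply: ge0_le_integral => //.
  - by move=> y _; rewrite lee_fin truncated_power_ge0.
  - by apply: emeasurable_funD; exact: measurable_funeM.
  - by move=> y _; exact: truncated_power_estimate.
have FF0 y : (0 <= \int[mu]_x F (y, x))%E by apply: integral_ge0.
rewrite ge0_integralD//; last 4 first.
- by move=> y _; rewrite mule_ge0 ?gagliardo_at_ge0// lee_fin ltW.
- exact: measurable_funeM.
- by move=> y _; rewrite mule_ge0// lee_fin ltW ?D_gt0.
- exact: measurable_funeM.
rewrite ge0_integralZl//; last 2 first.
- by move=> y _; exact: gagliardo_at_ge0.
- by rewrite lee_fin ltW.
rewrite ge0_integralZl//; last by rewrite lee_fin ltW ?D_gt0.
rewrite leeD2l// (EFinM (D K)) -muleA lee_wpmul2l ?lee_fin ?(ltW (D_gt0 K K0))//.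
rewrite (@fubini_tonelli _ _ _ _ _ mu mu F)// -IE -ge0_integralZl//; last first.
  by move=> x _; rewrite lee_fin truncated_power_ge0.
apply: ge0_le_integral.
- exact: measurableT.
- by move=> x _; apply: integral_ge0 => y _; exact: F0.
- exact: (@measurable_fun_fubini_tonelli_G _ _ _ _ _ mu F mF F0).
- exact: measurable_funeM.
- by move=> x _; rewrite -EFinM; exact: shell_power_integral.
Qed.

(** The left side is (eta/2) K^(al-n), so K^(n-al) >= eta suffices, which a large [K] achieves
    because al < n. The maximum with 1 secures [1 <= K]. *)
Let exists_scale : exists2 K, 1 <= K & D K * (6 * n) `^ n <= 2^-1.
Proof.
pose eta := 2 * C2 * 3 `^ al * (6 * n) `^ n.
have eta0 : 0 < eta by rewrite !mulr_gt0 ?powR_gt0 ?mulr_gt0.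
have nal : 0 < n - al by rewrite subr_gt0.
pose K := Num.max 1 (eta `^ (n - al)^-1); exists K.
  by rewrite le_max lexx.
have K0 : 0 < K by rewrite lt_max ltr01.
have etaK : eta <= K `^ (n - al).
  have -> : eta = (eta `^ (n - al)^-1) `^ (n - al).
    by rewrite -powRrM mulVf ?gt_eqF// powRr1// ltW.
  apply: ge0_ler_powR; rewrite ?nnegrE ?powR_ge0 ?(ltW nal) ?(ltW K0)//.
  by rewrite le_max lexx orbT.
rewrite /D (_ : al - n = - (n - al)) ?opprB// -[al - n]opprB powRN.
rewrite (_ : _ * _ * _ * _ = eta / 2 / K `^ (n - al)); last first.
  by rewrite /eta; field; rewrite gt_eqF ?powR_gt0.
by rewrite ler_pdivrMr ?powR_gt0//; lra.
Qed.

(** Half of [I], which is finite, is absorbed; division by I^(sig/n) then leaves I^(1 - sig/n) =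
    I^(p/q). [S] is fixed before [e] and [u], so the bound survives the limit e -> 0 and is uniform
    in [u]. *)
Lemma truncated_fractional_sobolev : exists2 S, 0 < S &
  forall e u I G, measurable_fun setT u -> 0 < e -> 0 <= I -> 0 <= G ->
  (\int[mu]_x (truncated_power e u x)%:E = I%:E)%E ->
  (\int[mu]_y gagliardo_at u y = G%:E)%E ->
  I `^ (p / q) <= S * G.
Proof.
have [K K1 KD] := exists_scale; have K0 : 0 < K by lra.
exists (2 * C3 K); first by rewrite mulr_gt0 ?C3_gt0.
move=> e u I G meas_u e0; rewrite le_eqVlt => /predU1P[<- G0 _ _|I0 G0 IE GE].
  rewrite powR0; first by rewrite mulr_ge0// mulr_ge0// ltW ?C3_gt0.
  by rewrite gt_eqF// divr_gt0.
have := truncated_power_integral_le K e u I meas_u K1 e0 I0 IE.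
rewrite GE -!EFinM -EFinD lee_fin => H.
have {H} H : I <= 2 * C3 K * I `^ (sig / n) * G.
  by have := ler_wpM2r (ltW I0) KD; move: H; lra.
have -> : p / q = 1 - sig / n.
  apply: (mulIf (lt0r_neq0 q_gt0)); rewrite divfK ?gt_eqF// mulrBl mul1r.
  by rewrite [_ / _ * q]mulrC thetaE; ring.
rewrite powRB; last by rewrite [I == 0]gt_eqF// implybT.
by rewrite powRr1 ?(ltW I0)// ler_pdivrMr ?powR_gt0// mulrAC.
Qed.

End weighted_fractional_sobolev.

(** * Bounds for test functions, removal of the truncation, and conclusion *)

Lemma test_function_bounded (R : realType) (N : nat) (u : 'rV[R]_N -> R) :
  test_function u -> exists M l : R, [/\ 0 <= l, forall x, `|u x| <= M &
    forall x, u x != 0 -> forall i, `|x ord0 i| <= l].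
Proof.
move=> [su cu]; have cont_u : continuous u := su 0%N.
have [M0 [_ HM]] : bounded_set (u @` closure [set x | u x != 0]).
  by apply/compact_bounded/continuous_compact => //; exact: continuous_subspaceT.
have [l0 [_ Hl]] := compact_bounded cu.
exists (`|M0| + 1), (`|l0| + 1); split; first by rewrite addr_ge0.
  move=> x; have [->|ux] := eqVneq (u x) 0; first by rewrite normr0 addr_ge0.
  apply: (HM (`|M0| + 1)); first by rewrite (le_lt_trans (ler_norm _))// ltrDl.
  by exists x => //; exact: subset_closure.
move=> x ux i; apply: le_trans (Hl (`|l0| + 1) _ x _).
(* The canonical norm is the maximum of the coordinates, so it dominates each of them. *)
- rewrite [leRHS]/Num.norm /= mx_normrE; apply/bigmax_geP; right => /=.
  by exists (ord0, i).
- by rewrite (le_lt_trans (ler_norm _))// ltrDl.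
- exact: subset_closure.
Qed.

(** Monotone convergence along the sets |x| >= 1/(k+1), whose union misses only the origin. *)
Lemma weighted_power_integral_le (R : realType) (N : nat) (q al b : R)
    (u : 'rV[R]_N -> R) :
  0 < al -> measurable_fun setT u ->
  (forall e, 0 < e ->
    (\int[lebesgue_rV R N]_x (truncated_power R N q al e u x)%:E <= b%:E)%E) ->
  (\int[lebesgue_rV R N]_x (weighted_power R N q al u x)%:E <= b%:E)%E.
Proof.
move=> al0 meas_u ub; set w := weighted_power R N q al u.
have mw : measurable_fun setT (fun x => (w x)%:E).
  by apply/measurable_EFinP; exact: measurable_weighted_power.
pose E (k : nat) : set 'rV[R]_N := [set x | k.+1%:R^-1 <= enorm x].
have mE k : measurable (E k).
  rewrite -[X in measurable X]setTI.
  have -> : E k = (@enorm R N) @^-1` `[k.+1%:R^-1, +oo[%classic.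
    by apply/seteqP; split => x; rewrite /E /= in_itv/= andbT.
  by apply: measurable_enorm => //; exact: measurable_itv.
have ndE : nondecreasing_seq E.
  move=> i j ij; apply/subsetPset => x; rewrite /E /=; apply: le_trans.
  by rewrite lef_pV2 ?posrE ?ltr0n// ler_nat ltnS.
have intE k : (\int[lebesgue_rV R N]_(x in E k) (w x)%:E =
    \int[lebesgue_rV R N]_x (truncated_power R N q al k.+1%:R^-1 u x)%:E)%E.
  rewrite integral_mkcond; apply: eq_integral => x _; rewrite patchE.
  rewrite /truncated_power; case: ifPn => [/set_mem|]; first by rewrite /E /= => ->.
  by rewrite notin_setE /E /= => /negP/negbTE ->.
have -> : (\int[lebesgue_rV R N]_x (w x)%:E =
    \int[lebesgue_rV R N]_(x in \bigcup_k E k) (w x)%:E)%E.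
  rewrite [RHS]integral_mkcond; apply: eq_integral => x _; rewrite patchE.
  case: ifPn => //; rewrite notin_setE => xE.
  suff -> : w x = 0 by [].
  (* At x = 0 the weighted power is 0, by division by 0. *)
  have [x0|x0] := eqVneq (enorm x) 0.
    by rewrite /w /weighted_power x0 powR0 ?invr0 ?mulr0// gt_eqF.
  exfalso; apply: xE.
  have {}x0 : 0 < enorm x by rewrite lt_neqAle eq_sym x0 enorm_ge0.
  exists (Num.truncn (enorm x)^-1) => //; rewrite /E /=.
  rewrite -[leRHS]invrK lef_pV2 ?posrE ?invr_gt0 ?ltr0n//.
  by apply: ltW; exact: truncnS_gt.
have cvgE := @ge0_nondecreasing_set_cvg_integral _ _ _ E (fun x => (w x)%:E)
  (lebesgue_rV R N) ndE mE (fun i => measurable_funTS mw)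
  (fun i x _ => weighted_power_ge0 R N q al u x).
rewrite -(cvg_lim _ cvgE)//; apply: lime_le.
  by apply/cvg_ex; eexists; exact: cvgE.
by near=> k; rewrite intE; apply: ub; rewrite invr_gt0.
Unshelve. all: by end_near. Qed.

Theorem theorem1p5 (R : realType) (N : nat) (s p beta : R) :
  0 < s < 1 -> 1 < p < N%:R / s -> 0 < beta < (N%:R - p * s) / 2 ->
  let ps := sobolev_exp N s p in
  exists2 S : R, 0 < S &
    forall u : 'rV[R]_N -> R, test_function u ->
    (S%:E * (\int[lebesgue_rV R N]_x
               (`|u x| `^ ps / enorm x `^ (2 * beta * ps / p))%:E) `^ (p / ps)
     <= \int[lebesgue_rV R N]_y \int[lebesgue_rV R N]_x
          (`|u x - u y| `^ p / enorm (x - y) `^ (N%:R + p * s)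
             / enorm x `^ beta / enorm y `^ beta)%:E)%E.
Proof.
move=> /andP[s0 _] /andP[p1] + /andP[be0].
rewrite ltr_pdivlMr// ltr_pdivlMr// => pN beN ps.
have p0 : 0 < p by rewrite (lt_trans _ p1).
have sig0 : 0 < p * s by rewrite mulr_gt0.
have N0 : (0 < N)%N by rewrite -(ltr0n R) (lt_trans sig0).
have Nps : 0 < N%:R - p * s by rewrite subr_gt0.
have ps0 : 0 < ps by rewrite divr_gt0// mulr_gt0// ltr0n.
have al0 : 0 < 2 * beta * ps / p by rewrite divr_gt0// mulr_gt0// mulr_gt0.
have qE : ps * (N%:R - p * s) = p * N%:R by rewrite divfK// gt_eqF.
have alE : 2 * beta * ps / p * p = 2 * beta * ps by rewrite divfK// gt_eqF.
have beN' : 2 * beta < N%:R - p * s by rewrite mulrC.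
have [S0 S00 HS] := truncated_fractional_sobolev R N p ps (p * s) beta
  (2 * beta * ps / p) N0 p0 sig0 be0 qE alE pN beN'.
(* [S0] stands on the side of the seminorm in the truncated inequality, so it is inverted here. *)
exists S0^-1; first by rewrite invr_gt0.
move=> u tu; have meas_u : measurable_fun setT u.
  by apply: continuous_measurable_rV; case: tu => /(_ 0%N).
pose J := (\int[lebesgue_rV R N]_x
  (weighted_power R N ps (2 * beta * ps / p) u x)%:E)%E.
pose G := (\int[lebesgue_rV R N]_y gagliardo_at R N p (p * s) beta u y)%E.
rewrite -[X in (X `^ _)%E]/J -[leRHS]/G.
have J0 : (0 <= J)%E by apply: integral_ge0 => x _; rewrite lee_fin weighted_power_ge0.
have G0 : (0 <= G)%E by apply: integral_ge0 => y _; exact: gagliardo_at_ge0.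
case GE : G G0 => [g| |]//; last by move=> _; exact: leey.
rewrite lee_fin => g0.
have [M [l [l0 uM ul]]] := test_function_bounded _ _ _ tu.
have SG0 : 0 <= S0 * g by rewrite mulr_ge0// ltW.
have pps0 : 0 < p / ps by rewrite divr_gt0.
(* The bound on I^(p/q) is first inverted into a bound on [I] independent of [e], which passes to
   the limit e -> 0 and also shows that [J] is finite. *)
have Jle : (J <= ((S0 * g) `^ (p / ps)^-1)%:E)%E.
  apply: weighted_power_integral_le => // e e0.
  set I := (X in (X <= _)%E).
  have I0 : (0 <= I)%E by apply: integral_ge0 => x _; rewrite lee_fin truncated_power_ge0.
  have Ifin : I \is a fin_num.
    rewrite ge0_fin_numE//.
    exact: (truncated_power_integral_lty _ _ _ _ _ _ _ N0 p0 be0 qE alE pN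
      e u M l).
  have Ig := HS e u (fine I) g meas_u e0 (fine_ge0 I0) g0 (esym (fineK Ifin)) GE.
  rewrite -(fineK Ifin) lee_fin.
  have -> : fine I = (fine I `^ (p / ps)) `^ (p / ps)^-1.
    by rewrite -powRrM divff ?gt_eqF// powRr1// fine_ge0.
  by apply: ge0_ler_powR; rewrite ?nnegrE ?powR_ge0 ?invr_ge0// ltW.
have Jfin : J \is a fin_num by rewrite ge0_fin_numE// (le_lt_trans Jle) ?ltry.
rewrite -(fineK Jfin) poweR_EFin -EFinM lee_fin mulrC ler_pdivrMr// [leRHS]mulrC.
have -> : S0 * g = ((S0 * g) `^ (p / ps)^-1) `^ (p / ps).
  by rewrite -powRrM mulVf ?gt_eqF// powRr1.
apply: ge0_ler_powR; rewrite ?nnegrE ?powR_ge0 ?fine_ge0 ?(ltW pps0)//.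
by rewrite -lee_fin fineK.
Qed.
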